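(* Let $E\subset\mathbb{H}^n$ be a closed set. Then the function $\xi_E:\operatorname{Unp}(E)\to E$ is continuous.
   Context: $\mathbb{H}^n$ is $\mathbb{R}^{2n+1}$ with coordinates $(x_1,y_1,\ldots,x_n,y_n,t)$, with the left-invariant vector fields $X_i=\partial_{x_i}+y_i\partial_t$, $Y_i=\partial_{y_i}-x_i\partial_t$ ($1\le i\le n$), $T=\partial_t$, and $n\ge 1$. The horizontal distribution $\mathcal{H}$ is spanned by the $X_i,Y_i$; the Riemannian metric makes $\{X_i,Y_i,T\}$ orthonormal. $d$ is the Carnot-Carathéodory distance (infimum of Riemannian lengths of piecewise smooth curves tangent to $\mathcal{H}$ joining two points). $\operatorname{Unp}(E)$ is the set of points $p\in\mathbb{H}^n$ for which there is a unique point of $E$ nearest to $p$ with respect to $d$, and $\xi_E(p)$ is that nearest point. *)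

(* Defs.v *)
From HB Require Import structures.
From mathcomp Require Import all_boot all_order all_algebra.
From mathcomp Require Import all_classical all_reals all_analysis.

Set Implicit Arguments.
Unset Strict Implicit.
Unset Printing Implicit Defensive.

Import Order.TTheory GRing.Theory Num.Theory.
Import numFieldNormedType.Exports.

Local Open Scope classical_set_scope.
Local Open Scope ring_scope.

(* R^(2n+1), with the usual topology; a point is
   (x_1, y_1, ..., x_n, y_n, t).  The same type serves for tangent vectors. *)
Notation heis R n := 'rV[R]_(n.*2.+1).

Section Indices.
Variable n : nat.

Lemma ix_subproof (i : 'I_n) : (i.*2 < n.*2.+1)%N.
Proof. by rewrite ltnS leq_double ltnW. Qed.

Lemma iy_subproof (i : 'I_n) : (i.*2.+1 < n.*2.+1)%N.
Proof. by rewrite ltnS ltn_double. Qed.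

Definition ix (i : 'I_n) : 'I_(n.*2.+1) := Ordinal (ix_subproof i).
Definition iy (i : 'I_n) : 'I_(n.*2.+1) := Ordinal (iy_subproof i).
Definition it : 'I_(n.*2.+1) := ord_max.

Lemma ix_inj : injective ix.
Proof. by move=> i j /(congr1 val)/= /double_inj/val_inj. Qed.

Lemma iy_inj : injective iy.
Proof. by move=> i j /(congr1 val)/= [] /double_inj/val_inj. Qed.

Lemma ix_neq_iy i j : (ix i == iy j) = false.
Proof.
by apply/negP => /eqP/(congr1 (odd \o val)); rewrite /= !odd_double.
Qed.

Lemma ix_neq_it i : (ix i == it) = false.
Proof.
apply/negP => /eqP/(congr1 val)/= /double_inj in0.
by move: (ltn_ord i); rewrite in0 ltnn.
Qed.

Lemma iy_neq_it i : (iy i == it) = false.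
Proof.
by apply/negP => /eqP/(congr1 (odd \o val)); rewrite /= !odd_double.
Qed.

End Indices.
Arguments it {n}.

Section Heisenberg.
Variables (R : realType) (n : nat).
Local Notation H := (heis R n).
Implicit Types (p q v w : H) (E : set H).

Definition coordx p (i : 'I_n) : R := p 0 (ix i).
Definition coordy p (i : 'I_n) : R := p 0 (iy i).
Definition coordt p : R := p 0 it.

Definition fieldX (i : 'I_n) p : H :=
  delta_mx 0 (ix i) + coordy p i *: delta_mx 0 it.
Definition fieldY (i : 'I_n) p : H :=
  delta_mx 0 (iy i) - coordx p i *: delta_mx 0 it.
Definition fieldT p : H := delta_mx 0 it.

(* v belongs to the fibre at p of the horizontal distribution *)
Definition horizontal p v : Prop :=
  exists a b : 'I_n -> R,
    v = \sum_(i < n) (a i *: fieldX i p + b i *: fieldY i p).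

(* In the frame X_i, Y_i, T at p, the vector v has X_i-component coordx v i,
   Y_i-component coordy v i and T-component vertical p v. *)
Definition vertical p v : R :=
  coordt v
  - \sum_(i < n) (coordy p i * coordx v i - coordx p i * coordy v i).

Definition metric p v w : R :=
  \sum_(i < n) (coordx v i * coordx w i + coordy v i * coordy w i)
  + vertical p v * vertical p w.

Definition riem_norm p v : R := Num.sqrt (metric p v v).

(* A map on a closed interval is smooth when it extends to a smooth map on
   the line. *)
Definition smooth (g : R -> H) : Prop :=
  forall (k : nat) (s : R), derivable (derive1n k g) s 1.

Definition smooth_on (a b : R) (f : R -> H) : Prop :=
  exists2 g, smooth g & {in `[a, b], f =1 g}.

(* The breakpoints a = s_0 < s_1 < ... < s_k = b are those of a :: s. *)
Definition horizontal_curve (a b : R) (f : R -> H) : Prop :=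
  {within `[a, b], continuous f} /\
  exists2 s : seq R, itv_partition a b s &
    forall k, (k < size s)%N ->
      let c := nth b (a :: s) k in
      let d := nth b (a :: s) k.+1 in
      smooth_on c d f /\
      (forall u, u \in `]c, d[ -> horizontal (f u) (derive1 f u)).

(* At the finitely many breakpoints derive1 f may be meaningless; they are
   negligible. *)
Definition curve_length (a b : R) (f : R -> H) : \bar R :=
  (\int[lebesgue_measure]_(u in `[a, b]) (riem_norm (f u) (derive1 f u))%:E)%E.

Definition cc_dist p q : \bar R :=
  ereal_inf [set l | exists a b f,
    [/\ a < b, horizontal_curve a b f, f a = p, f b = q
      & l = curve_length a b f]].

Definition nearest E p : set H :=
  [set q | E q /\ forall q', E q' -> (cc_dist p q <= cc_dist p q')%E].

Definition Unp E : set H := [set p | exists! q, nearest E p q].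

(* Only the values on Unp E are meaningful. *)
Definition xi E (p : H) : H := xget 0 (nearest E p).

Lemma xiP E p : Unp E p -> nearest E p (xi E p).
Proof. by case=> q [Eq _]; exact: xgetI Eq. Qed.

Lemma coordx_fieldX p i j : coordx (fieldX i p) j = (i == j)%:R.
Proof.
by rewrite /coordx !mxE !eqxx /= ix_neq_it mulr0 addr0 (inj_eq (@ix_inj n)) eq_sym.
Qed.

Lemma coordy_fieldX p i j : coordy (fieldX i p) j = 0.
Proof.
by rewrite /coordy !mxE !eqxx /= iy_neq_it mulr0 addr0 eq_sym ix_neq_iy.
Qed.

Lemma coordx_fieldY p i j : coordx (fieldY i p) j = 0.
Proof.
by rewrite /coordx !mxE !eqxx /= ix_neq_it mulr0 subr0 ix_neq_iy.
Qed.

Lemma coordy_fieldY p i j : coordy (fieldY i p) j = (i == j)%:R.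
Proof.
by rewrite /coordy !mxE !eqxx /= iy_neq_it mulr0 subr0 (inj_eq (@iy_inj n)) eq_sym.
Qed.

Lemma coordx_fieldT p j : coordx (fieldT p) j = 0.
Proof. by rewrite /coordx !mxE !eqxx /= ix_neq_it. Qed.

Lemma coordy_fieldT p j : coordy (fieldT p) j = 0.
Proof. by rewrite /coordy !mxE !eqxx /= iy_neq_it. Qed.

Let sum_delta (F : 'I_n -> R) i : \sum_(j < n) F j * (i == j)%:R = F i.
Proof.
rewrite (bigD1 i) //= eqxx mulr1 big1 ?addr0// => j ji.
by rewrite eq_sym (negbTE ji) mulr0.
Qed.

Lemma vertical_fieldX p i : vertical p (fieldX i p) = 0.
Proof.
rewrite /vertical.
under eq_bigr => j _ do rewrite coordx_fieldX coordy_fieldX mulr0 subr0.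
rewrite sum_delta /coordt !mxE !eqxx /= (eq_sym it) ix_neq_it add0r mulr1.
by rewrite subrr.
Qed.

Lemma vertical_fieldY p i : vertical p (fieldY i p) = 0.
Proof.
rewrite /vertical.
under eq_bigr => j _ do rewrite coordx_fieldY coordy_fieldY mulr0 sub0r.
rewrite sumrN sum_delta /coordt !mxE !eqxx /= (eq_sym it) iy_neq_it.
by rewrite sub0r mulr1 subrr.
Qed.

Lemma vertical_fieldT p : vertical p (fieldT p) = 1.
Proof.
rewrite /vertical big1 => [|j _]; first by rewrite subr0 /coordt !mxE !eqxx.
by rewrite coordx_fieldT coordy_fieldT !mulr0 subr0.
Qed.

Lemma metric_frame p :
  [/\ forall i j, metric p (fieldX i p) (fieldX j p) = (i == j)%:R,
      forall i j, metric p (fieldY i p) (fieldY j p) = (i == j)%:R,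
      forall i j, metric p (fieldX i p) (fieldY j p) = 0,
      forall i, metric p (fieldX i p) (fieldT p) = 0 /\
                metric p (fieldY i p) (fieldT p) = 0
    & metric p (fieldT p) (fieldT p) = 1].
Proof.
split=> [i j|i j|i j|i|]; rewrite /metric.
- rewrite !vertical_fieldX mul0r addr0.
  under eq_bigr => k _ do rewrite !coordx_fieldX !coordy_fieldX mul0r addr0.
  by rewrite sum_delta.
- rewrite !vertical_fieldY mul0r addr0.
  under eq_bigr => k _ do rewrite !coordx_fieldY !coordy_fieldY mul0r add0r.
  by rewrite sum_delta.
- rewrite vertical_fieldX mul0r addr0 big1// => k _.
  by rewrite coordx_fieldY coordy_fieldX mulr0 mul0r addr0.
- split; rewrite ?vertical_fieldX ?vertical_fieldY mul0r addr0 big1// => k _;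
    by rewrite coordx_fieldT coordy_fieldT !mulr0 addr0.
- rewrite vertical_fieldT mulr1 big1 ?add0r// => k _.
  by rewrite coordx_fieldT coordy_fieldT !mulr0 addr0.
Qed.

End Heisenberg.

(* Main.v *)
Require Import Defs.
From mathcomp Require Import all_boot all_order all_algebra.
From mathcomp Require Import all_classical all_reals all_analysis.
From mathcomp Require Import measurable_realfun ring lra.
Import Order.TTheory GRing.Theory Num.Theory.
Import numFieldNormedType.Exports.
Local Open Scope classical_set_scope.
Local Open Scope ring_scope.

Set Implicit Arguments.
Unset Strict Implicit.
Unset Printing Implicit Defensive.

(** If points p' of Unp E tend to p in Unp E, their nearest points stay in a
compact set, and every limit q of these nearest points is itself nearest to p:
d(p, q) is at most d(p', xi p') + o(1), which is at most d(p', q') + o(1) and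
hence at most d(p, q') + o(1), for every q' in E.  As p has a single nearest
point, the nearest points converge to it.  Two facts about the
Carnot-Caratheodory distance carry this.

- Nearby points for the usual topology are close for d ([reach_near]).  The
  line p + s v is horizontal as soon as v is horizontal at p, because the
  symplectic form defining the distribution is alternating, so such a line
  costs its norm.  A point p' near p is reached by one horizontal line and a
  vertical correction, and a vertical displacement t is the effect of four
  lines of length sqrt (|t| / 2) along X, Y, -X, -Y ([four_steps]).  To
  turn costs into bounds on d, a segment is glued to a horizontal curve at
  either end ([curve_concat]); since the segment can be parametrised next to
  the interval of the curve, no change of variable is needed.

- d-balls are bounded in coordinates, uniformly for bounded centres
  ([cc_ball_bounded]).  Along a horizontal curve the derivatives of x_i and y_i
  are at most the speed, so x_i and y_i vary by at most the length; then the
  derivative of t, which is the sum of the y_i x_i' - x_i y_i', is at most a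
  constant times the speed, and t is bounded in turn ([hpieces_growth]).

The topological conclusion is that a filter living in a compact set with a
single cluster point converges to it. *)

(** * Linear algebra of the horizontal distribution *)

Section Algebra.
Variables (R : realType) (n : nat).
Local Notation H := (heis R n).
Implicit Types (p q v w : H).

Lemma heis_indexP (P : 'I_(n.*2.+1) -> Prop) :
  (forall i, P (ix i)) -> (forall i, P (iy i)) -> P it -> forall k, P k.
Proof.
move=> Px Py Pt k; have [kt|kt] := eqVneq k it; first by rewrite kt.
have kn : (k < n.*2)%N.
  have := ltn_ord k; rewrite ltnS leq_eqVlt => /predU1P[kE|//].
  by case/eqP: kt; apply: val_inj.
have k2 : (k./2 < n)%N.
  rewrite -ltn_double (leq_ltn_trans _ kn)//.
  by rewrite -{2}(odd_double_half k) leq_addl.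
have [ko|ke] := boolP (odd k).
- suff -> : k = iy (Ordinal k2) by exact: Py.
  by apply: val_inj; rewrite /= -{1}(odd_double_half k) ko.
- suff -> : k = ix (Ordinal k2) by exact: Px.
  by apply: val_inj; rewrite /= -{1}(odd_double_half k) (negbTE ke).
Qed.

Lemma heisP v w : (forall i, coordx v i = coordx w i) ->
  (forall i, coordy v i = coordy w i) -> coordt v = coordt w -> v = w.
Proof.
move=> ex ey et; apply/rowP; exact: heis_indexP.
Qed.

Lemma coordxD v w i : coordx (v + w) i = coordx v i + coordx w i.
Proof. by rewrite /coordx mxE. Qed.
Lemma coordyD v w i : coordy (v + w) i = coordy v i + coordy w i.
Proof. by rewrite /coordy mxE. Qed.
Lemma coordtD v w : coordt (v + w) = coordt v + coordt w.
Proof. by rewrite /coordt mxE. Qed.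
Lemma coordxZ a v i : coordx (a *: v) i = a * coordx v i.
Proof. by rewrite /coordx mxE. Qed.
Lemma coordyZ a v i : coordy (a *: v) i = a * coordy v i.
Proof. by rewrite /coordy mxE. Qed.
Lemma coordtZ a v : coordt (a *: v) = a * coordt v.
Proof. by rewrite /coordt mxE. Qed.
Lemma coordt_fieldX p i : coordt (fieldX i p) = coordy p i.
Proof. by rewrite /coordt !mxE !eqxx eq_sym ix_neq_it add0r mulr1. Qed.
Lemma coordt_fieldY p i : coordt (fieldY i p) = - coordx p i.
Proof. by rewrite /coordt !mxE !eqxx eq_sym iy_neq_it add0r mulr1. Qed.
Lemma coordt_fieldT p : coordt (fieldT p) = 1.
Proof. by rewrite /coordt !mxE !eqxx. Qed.

Definition coordE := (coordx_fieldX, coordx_fieldY, coordx_fieldT,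
  coordy_fieldX, coordy_fieldY, coordy_fieldT,
  coordt_fieldX, coordt_fieldY, coordt_fieldT,
  coordxD, coordyD, coordtD, coordxZ, coordyZ, coordtZ).

Lemma verticalD p v w : vertical p (v + w) = vertical p v + vertical p w.
Proof.
rewrite /vertical coordtD.
under eq_bigr do rewrite coordxD coordyD !mulrDr opprD addrACA.
by rewrite big_split/= opprD addrACA.
Qed.

Lemma verticalZ p a v : vertical p (a *: v) = a * vertical p v.
Proof.
rewrite /vertical coordtZ mulrBr mulr_sumr; congr (_ - _).
by apply: eq_bigr => i _; rewrite coordxZ coordyZ; ring.
Qed.

(** The base point enters the vertical component through a symplectic form,
which is alternating: moving along v does not change the vertical component of
v.  Straight lines in horizontal directions are therefore horizontal curves of
constant speed. *)
Lemma vertical_shift p v a : vertical (p + a *: v) v = vertical p v.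
Proof.
rewrite /vertical; congr (_ - _).
by apply: eq_bigr => i _; rewrite !coordE; ring.
Qed.

Lemma horizontalP p v : horizontal p v <-> vertical p v = 0.
Proof.
split=> [[a [b ->]]|v0].
  apply: (big_ind (fun u => vertical p u = 0)).
  - by rewrite -(scale0r 0) verticalZ mul0r.
  - by move=> u w u0 w0; rewrite verticalD u0 w0 addr0.
  - move=> i _; rewrite verticalD !verticalZ vertical_fieldX vertical_fieldY.
    by rewrite !mulr0 addr0.
have coordx_sum (F : 'I_n -> H) i : coordx (\sum_j F j) i = \sum_j coordx (F j) i.
  by rewrite /coordx summxE.
have coordy_sum (F : 'I_n -> H) i : coordy (\sum_j F j) i = \sum_j coordy (F j) i.
  by rewrite /coordy summxE.
have coordt_sum (F : 'I_n -> H) : coordt (\sum_j F j) = \sum_j coordt (F j).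
  by rewrite /coordt summxE.
exists (coordx v), (coordy v); apply: heisP => [i|i|].
- rewrite coordx_sum (bigD1 i)//= !coordE eqxx mulr1 mulr0 addr0.
  rewrite big1 ?addr0// => j /negbTE ji.
  by rewrite !coordE ji !mulr0 addr0.
- rewrite coordy_sum (bigD1 i)//= !coordE eqxx mulr1 mulr0 add0r.
  rewrite big1 ?addr0// => j /negbTE ji.
  by rewrite !coordE ji !mulr0 addr0.
- move/eqP: v0; rewrite /vertical subr_eq0 => /eqP ->; rewrite coordt_sum.
  by apply: eq_bigr => i _; rewrite !coordE; ring.
Qed.

Lemma normr_le_riem_norm p v c : c ^+ 2 <= metric p v v -> `|c| <= riem_norm p v.
Proof. by move=> cv; rewrite -sqrtr_sqr ler_wsqrtr. Qed.

Lemma coordxy_le_metric p v i : coordx v i ^+ 2 + coordy v i ^+ 2 <= metric p v v.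
Proof.
rewrite /metric (bigD1 i)//= -!expr2 -addrA lerDl.
rewrite addr_ge0 ?sqr_ge0 ?sumr_ge0// => j _.
by rewrite -!expr2 addr_ge0 ?sqr_ge0.
Qed.

Lemma coordx_le_riem_norm p v i : `|coordx v i| <= riem_norm p v.
Proof.
apply: normr_le_riem_norm; apply: le_trans (coordxy_le_metric p v i).
by rewrite lerDl sqr_ge0.
Qed.

Lemma coordy_le_riem_norm p v i : `|coordy v i| <= riem_norm p v.
Proof.
apply: normr_le_riem_norm; apply: le_trans (coordxy_le_metric p v i).
by rewrite lerDr sqr_ge0.
Qed.

Lemma riem_normZ p a v : riem_norm p (a *: v) = `|a| * riem_norm p v.
Proof.
rewrite /riem_norm -sqrtr_sqr -sqrtrM ?sqr_ge0//; congr (Num.sqrt _).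
rewrite /metric verticalZ [RHS]mulrDr mulr_sumr; congr (_ + _); last by ring.
by apply: eq_bigr => i _; rewrite !coordE; ring.
Qed.

Lemma riem_norm_fieldX p i : riem_norm p (fieldX i p) = 1.
Proof.
have [+ _ _ _ _] := metric_frame p; rewrite /riem_norm => ->.
by rewrite eqxx sqrtr1.
Qed.

Lemma riem_norm_fieldY p i : riem_norm p (fieldY i p) = 1.
Proof.
have [_ + _ _ _] := metric_frame p; rewrite /riem_norm => ->.
by rewrite eqxx sqrtr1.
Qed.

Lemma riem_norm_shift p v a : riem_norm (p + a *: v) v = riem_norm p v.
Proof. by rewrite /riem_norm /metric vertical_shift. Qed.

(** The commutator of the flows of X_i and Y_i is vertical: a parallelogram in
the (x_i, y_i)-plane lifts to a path whose endpoints differ by twice its area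
in the direction of t. *)
Lemma four_steps p i a b :
  let p1 := p + a *: fieldX i p in let p2 := p1 + b *: fieldY i p1 in
  let p3 := p2 + (- a) *: fieldX i p2 in
  p3 + (- b) *: fieldY i p3 = p + (- (2 * a * b)) *: fieldT p.
Proof.
move=> p1 p2 p3.
apply: heisP => [j|j|]; rewrite /p3 /p2 /p1 !coordE ?eqxx /=; ring.
Qed.

End Algebra.

(** * Continuity and growth estimates *)

Section Analysis.
Variables (R : realType) (n : nat).
Local Notation H := (heis R n).
Local Notation mu := (@lebesgue_measure R).
Implicit Types (p q v w : H) (f g : R -> H).

Lemma cvg_vertical (T : Type) (F : set_system T) (P V : T -> H) p v :
  Filter F -> P @ F --> p -> V @ F --> v ->
  vertical (P u) (V u) @[u --> F] --> vertical p v.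
Proof.
move=> FF Pp Vv.
have c0 (W : T -> H) w k : W @ F --> w -> W u 0 k @[u --> F] --> w 0 k.
  by move=> Ww; exact: (cvg_comp _ _ Ww (@coord_continuous R 1 _ 0 k w)).
apply: cvgB; first exact: c0.
apply: cvg_big => [|i _]; first exact: add_continuous.
  apply: cvgB; apply: cvgM; exact: c0.
Qed.

Lemma cvg_riem_norm (T : Type) (F : set_system T) (P V : T -> H) p v :
  Filter F -> P @ F --> p -> V @ F --> v ->
  riem_norm (P u) (V u) @[u --> F] --> riem_norm p v.
Proof.
move=> FF Pp Vv.
have c0 k : V u 0 k @[u --> F] --> v 0 k.
  by exact: (cvg_comp _ _ Vv (@coord_continuous R 1 _ 0 k v)).
apply: cvg_comp; last exact: sqrt_continuous.
apply: cvgD; last by apply: cvgM; exact: cvg_vertical.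
apply: cvg_big => [|i _]; first exact: add_continuous.
by apply: cvgD; apply: cvgM; exact: c0.
Qed.

Lemma derive1_coord f k u : derivable f u 1 ->
  derive1 (fun x => f x 0 k) u = derive1 f u 0 k.
Proof. by move=> df; rewrite !derive1E derive_mx// mxE. Qed.

Definition speed f (u : R) : R := riem_norm (f u) (derive1 f u).

Lemma speed_ge0 f u : 0 <= speed f u.
Proof. exact: sqrtr_ge0. Qed.

Lemma smooth_continuous g : smooth g -> continuous g.
Proof.
by move=> sg u; apply: differentiable_continuous; apply/derivable1_diffP/(sg 0).
Qed.

Lemma smooth_derive1_continuous g : smooth g -> continuous (derive1 g).
Proof.
by move=> sg u; apply: differentiable_continuous; apply/derivable1_diffP/(sg 1).
Qed.

Lemma smooth_speed_continuous g : smooth g -> continuous (speed g).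
Proof.
move=> sg u; apply: cvg_riem_norm; first exact: smooth_continuous.
exact: smooth_derive1_continuous.
Qed.

(** The bound on the derivative is asked for on the open interval only, as the
speed of a piecewise smooth curve is meaningless at the breakpoints. *)
Lemma C1_growth (phi F : R -> R) (a b C : R) : a <= b -> 0 <= C ->
  (forall u, derivable phi u 1) -> continuous (derive1 phi) ->
  measurable_fun `]a, b[ F -> (forall u, 0 <= F u) ->
  (forall u, u \in `]a, b[ -> `|derive1 phi u| <= C * F u) ->
  (`|phi b - phi a|%:E <= C%:E * \int[mu]_(u in `[a, b]) (F u)%:E)%E.
Proof.
rewrite le_eqVlt => /predU1P[<-|ab] C0 dphi cphi mF F0 le_phi.
  rewrite subrr normr0 mule_ge0 ?lee_fin// integral_ge0// => u _.
  by rewrite lee_fin.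
have phic : continuous phi.
  by move=> u; apply: differentiable_continuous; exact/derivable1_diffP.
have : (\int[mu]_(u in `[a, b]) (derive1 phi u)%:E = (phi b)%:E - (phi a)%:E)%E.
  apply: (continuous_FTC2 ab); first exact: continuous_subspaceT.
    split; first by move=> u _; exact: dphi.
      exact: (cvg_at_right_filter (phic a)).
    exact: (cvg_at_left_filter (phic b)).
  by [].
rewrite -EFinB => int_phi.
rewrite -abse_EFin -int_phi.
have mphi : measurable_fun `[a, b] (derive1 phi).
  by apply: measurable_funS (continuous_measurable_fun cphi).
have mFE : measurable_fun `]a, b[ (fun u => (F u)%:E) by exact/measurable_EFinP.
apply: le_trans (le_abse_integral _ _ _) _ => //; first exact/measurable_EFinP.
have mabs : measurable_fun `]a, b[ (fun u => `|derive1 phi u|%:E).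
  apply/measurable_EFinP/measurableT_comp => //.
  by apply: measurable_funS mphi => //; exact: subset_itv_oo_cc.
rewrite (integral_itv_bndoo _ _ mabs) (integral_itv_bndoo _ _ mFE).
rewrite -ge0_integralZl_EFin//; last by move=> u _; rewrite lee_fin.
by apply: ge0_le_integral => //; exact: measurable_funeM.
Qed.

End Analysis.

(** * Piecewise smooth horizontal curves *)

Section Curves.
Variables (R : realType) (n : nat).
Local Notation H := (heis R n).
Local Notation mu := (@lebesgue_measure R).
Implicit Types (p q v w : H) (f g : R -> H) (a b c d u : R) (s : seq R).

Definition hpiece f c d : Prop :=
  smooth_on c d f /\ forall u, u \in `]c, d[ -> horizontal (f u) (derive1 f u).

(** A recursive form of the condition on the pieces of a partition, suited to
induction along the curve. *)
Fixpoint hpieces f a s : Prop :=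
  if s is c :: s' then [/\ a < c, hpiece f a c & hpieces f c s'] else True.

Lemma horizontal_curveP a b f : horizontal_curve a b f <->
  {within `[a, b], continuous f} /\ exists2 s, last a s = b & hpieces f a s.
Proof.
have pathP s : forall c, (path <%R c s /\ forall k, (k < size s)%N ->
    hpiece f (nth b (c :: s) k) (nth b (c :: s) k.+1)) <-> hpieces f c s.
  elim: s => [|d s IH] c /=; first by split=> // _; split.
  split=> [[/andP[cd ds] ps]|[cd pcd /IH[ds ps]]].
    split=> //; first exact: (ps 0).
    by apply/IH; split=> // k ks; exact: (ps k.+1).
  by split=> [|[|k] ks //]; [exact/andP|exact: ps].
split=> -[cf [s]].
- by move=> [ps /eqP lb] hs; split=> //; exists s => //; apply/pathP.
- by move=> lb /pathP[ps hs]; split=> //; exists s => //; split=> //; exact/eqP.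
Qed.

Lemma derive1_eq_in c d f g : {in `]c, d[, f =1 g} ->
  {in `]c, d[, derive1 f =1 derive1 g}.
Proof.
move=> fg u ucd; rewrite !derive1E; apply: near_eq_derive.
by apply: filterS (near_in_itvoo ucd) => x; exact: fg.
Qed.

Lemma speed_eq_in c d f g : {in `]c, d[, f =1 g} ->
  {in `]c, d[, speed f =1 speed g}.
Proof. by move=> fg u ucd; rewrite /speed (fg _ ucd) (derive1_eq_in fg ucd). Qed.

Lemma hpiece_eq f g c d : {in `[c, d], f =1 g} -> hpiece f c d -> hpiece g c d.
Proof.
move=> fg [[h sh fh] hf].
have fgo : {in `]c, d[, f =1 g} by move=> u /subset_itv_oo_cc; exact: fg.
split; first by exists h => // u ucd; rewrite -fg// fh.
move=> u ucd; rewrite -(fgo _ ucd) -(derive1_eq_in fgo ucd).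
exact: hf.
Qed.

Lemma hpieces_le f s a : hpieces f a s -> a <= last a s.
Proof.
elim: s a => [|c s IH] a //= [ac _ /IH]; exact: le_trans (ltW ac).
Qed.

Lemma hpieces_eq f g s a :
  {in `[a, last a s], f =1 g} -> hpieces f a s -> hpieces g a s.
Proof.
elim: s a => [|c s IH] a //= fg [ac hac hs]; have cs := hpieces_le hs.
split=> //.
- apply: hpiece_eq hac => u; rewrite !in_itv/= => /andP[au uc].
  by apply: fg; rewrite in_itv/= au (le_trans uc).
- apply: IH hs => u; rewrite !in_itv/= => /andP[cu us].
  by apply: fg; rewrite in_itv/= us (le_trans (ltW ac)).
Qed.

Lemma hpieces_cat f s1 s2 a : hpieces f a s1 -> hpieces f (last a s1) s2 ->
  hpieces f a (s1 ++ s2).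
Proof.
by elim: s1 a => [|c s1 IH] a //= [ac hac h1] h2; split=> //; exact: IH.
Qed.

Lemma hpiece_measurable f c d : hpiece f c d -> measurable_fun `[c, d] (speed f).
Proof.
move=> [[g sg fg] _].
have fgo : {in `]c, d[, g =1 f} by move=> u /subset_itv_oo_cc/fg.
apply: (@measurable_fun_itv_cc _ _ _ false true).
apply: (@eq_measurable_fun _ _ _ _ _ (speed g)).
  by move=> u; rewrite inE/= => /(speed_eq_in fgo).
by apply: measurable_funS
  (continuous_measurable_fun (smooth_speed_continuous sg)).
Qed.

(** Measurability of the speed is what makes the length additive; whatever
derive1 returns at the breakpoints, they form a finite set. *)
Lemma hpieces_measurable f s a :
  hpieces f a s -> measurable_fun `[a, last a s] (speed f).
Proof.
elim: s a => [|c s IH] a /=.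
  by move=> _; rewrite set_itv1; exact: measurable_fun_set1.
move=> [ac hac hs]; have cs := hpieces_le hs.
rewrite (@itv_bndbnd_setU _ _ _ (BRight c)) ?bnd_simp//; last exact: ltW.
apply/measurable_funU => //; split; first exact: hpiece_measurable hac.
exact: measurable_fun_itv_oc (IH _ hs).
Qed.

Lemma integral_itv_split (F : R -> R) a b c : a <= b <= c ->
  measurable_fun `[a, c] F -> (forall u, 0 <= F u) ->
  (\int[mu]_(u in `[a, c]) (F u)%:E =
   \int[mu]_(u in `[a, b]) (F u)%:E + \int[mu]_(u in `[b, c]) (F u)%:E)%E.
Proof.
move=> /andP[ab bc] mF F0.
have acE : `[a, c]%classic = `[a, b] `|` `]b, c].
  by rewrite -itv_bndbnd_setU// bnd_simp.
have mFbc : measurable_fun `]b, c] (EFin \o F).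
  apply/measurable_EFinP; apply: measurable_funS mF => //.
  by rewrite acE; exact: subsetUr.
rewrite -(integral_itv_obnd_cbnd mFbc) acE ge0_integral_setU//.
- by rewrite -acE; exact/measurable_EFinP.
- by move=> u _; rewrite lee_fin.
- apply/disj_setPS => u [/=]; rewrite !in_itv/= => /andP[_ ub] /andP[bu _].
  by move: bu; rewrite ltNge ub.
Qed.

Lemma hpiece_growth f c d C (k : 'I_(n.*2.+1)) : hpiece f c d -> 0 <= C ->
  (forall u v, u \in `[c, d] -> horizontal (f u) v ->
    `|v 0 k| <= C * riem_norm (f u) v) ->
  forall u, u \in `[c, d] ->
  (`|f u 0 k - f c 0 k|%:E <= C%:E * \int[mu]_(x in `[c, u]) (speed f x)%:E)%E.
Proof.
move=> hcd C0 le_v u; have [[g sg fg] hf] := hcd.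
rewrite in_itv/= => /andP[cu ud]; have cd := le_trans cu ud.
rewrite !fg ?in_itv/= ?lexx ?cu ?cd//.
have dg x : derivable g x 1 := sg 0 x.
have d1E x : derive1 (fun y => g y 0 k) x = derive1 g x 0 k by exact: derive1_coord.
apply: (@C1_growth _ (fun x => g x 0 k)) => //.
- by move=> x; have /derivable_mxP := dg x; exact.
- rewrite (_ : derive1 _ = fun x => derive1 g x 0 k); last exact/funext.
  move=> x; apply: (@continuous_comp _ _ _ (derive1 g) (fun M : H => M 0 k)).
    exact: smooth_derive1_continuous.
  exact: coord_continuous.
- apply: measurable_funS (hpiece_measurable hcd) => // x /=.
  by rewrite !in_itv/= => /andP[/ltW -> /ltW xu]; exact: le_trans xu ud.
- exact: speed_ge0.
- move=> x; rewrite in_itv/= => /andP[cx xu]; rewrite d1E.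
  have xcd : x \in `]c, d[ by rewrite in_itv/= cx (lt_le_trans xu).
  rewrite -(@derive1_eq_in c d f g _ x xcd); last first.
    by move=> y /subset_itv_oo_cc/fg.
  by apply: le_v; [exact: subset_itv_oo_cc|exact: hf].
Qed.

(** The hypothesis bounds a coordinate of all horizontal vectors along the curve,
rather than that of its derivative, which is meaningless at the breakpoints.
The conclusion bounds the displacement of every point of the
curve, not only of its endpoint: the estimate for t requires control of x and y
all along. *)
Lemma hpieces_growth f s a C (k : 'I_(n.*2.+1)) : hpieces f a s -> 0 <= C ->
  (forall u v, u \in `[a, last a s] -> horizontal (f u) v ->
    `|v 0 k| <= C * riem_norm (f u) v) ->
  forall u, u \in `[a, last a s] ->
  (`|f u 0 k - f a 0 k|%:E <=
   C%:E * \int[mu]_(x in `[a, last a s]) (speed f x)%:E)%E.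
Proof.
elim: s a => [|c s IH] a /=.
  move=> _ C0 _ u; rewrite in_itv/= => /andP[au ua].
  have -> : u = a by apply/eqP; rewrite eq_le ua au.
  rewrite subrr normr0 mule_ge0 ?lee_fin// integral_ge0// => x _.
  by rewrite lee_fin speed_ge0.
move=> hacs C0 le_v u.
have [ac hac hs] := hacs; have cs := hpieces_le hs.
have mF : measurable_fun `[a, last c s] (speed f).
  exact: (hpieces_measurable (s := c :: s)).
have hc x : x \in `[a, c] -> (`|f x 0 k - f a 0 k|%:E <=
    C%:E * \int[mu]_(x in `[a, c]) (speed f x)%:E)%E.
  move=> xac; apply: le_trans (hpiece_growth (k := k) hac C0 _ xac) _.
    move=> y v; rewrite in_itv/= => /andP[ay yc]; apply: le_v.
    by rewrite in_itv/= ay (le_trans yc).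
  rewrite lee_wpmul2l ?lee_fin//; apply: ge0_subset_integral => //.
  - by apply/measurable_EFinP; exact: hpiece_measurable.
  - by move=> y _; rewrite lee_fin speed_ge0.
  - move: xac; rewrite in_itv/= => /andP[_ xc] y /=.
    by rewrite !in_itv/= => /andP[-> yx]; exact: le_trans xc.
have I0 x y : (0 <= \int[mu]_(x in `[x, y]) (speed f x)%:E)%E.
  by apply: integral_ge0 => z _; rewrite lee_fin speed_ge0.
rewrite (@integral_itv_split _ _ c) ?(ltW ac)//; last exact: speed_ge0.
rewrite ge0_muleDr// in_itv/= => /andP[au us].
have [uc|/ltW cu] := leP u c.
  apply: le_trans (hc u _) _; first by rewrite in_itv/= au.
  by rewrite leeDl// mule_ge0// lee_fin.
have -> : f u 0 k - f a 0 k = (f c 0 k - f a 0 k) + (f u 0 k - f c 0 k) by ring.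
apply: le_trans (_ : _ <= `|f c 0 k - f a 0 k|%:E + `|f u 0 k - f c 0 k|%:E)%E _.
  by rewrite -EFinD lee_fin ler_normD.
apply: leeD; first by apply: hc; rewrite in_itv/= lexx ltW.
apply: IH => //; last by rewrite in_itv/= cu.
move=> x v; rewrite in_itv/= => /andP[cx xs]; apply: le_v.
by rewrite in_itv/= xs (le_trans (ltW ac)).
Qed.

Lemma curve_length_eq a b f g : {in `]a, b[, f =1 g} ->
  measurable_fun `[a, b] (speed f) -> curve_length a b f = curve_length a b g.
Proof.
move=> fg mf; have sfg := speed_eq_in fg.
have mfo : measurable_fun `]a, b[ (speed f).
  by apply: measurable_funS mf => //; exact: subset_itv_oo_cc.
have mgo : measurable_fun `]a, b[ (speed g).
  by apply: eq_measurable_fun mfo => u; rewrite inE/=; exact: sfg.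
exact: eq_integral_itv_bounded mfo mgo sfg.
Qed.

Lemma curve_concat a b c f g : a <= b -> b <= c ->
  horizontal_curve a b f -> horizontal_curve b c g -> f b = g b ->
  exists h, [/\ horizontal_curve a c h, h a = f a, h c = g c &
    curve_length a c h = (curve_length a b f + curve_length b c g)%E].
Proof.
move=> ab bc /horizontal_curveP[cf [s1 ls1 hf]].
move=> /horizontal_curveP[cg [s2 ls2 hg]] fgb.
pose h u := if u <= b then f u else g u.
have hfE : {in `[a, b], f =1 h}.
  by move=> u; rewrite in_itv/= /h => /andP[_ ->].
have hgE : {in `[b, c], g =1 h}.
  move=> u; rewrite in_itv/= /h => /andP[bu _]; case: leP => // ub.
  by rewrite (_ : u = b) ?fgb//; apply/eqP; rewrite eq_le ub bu.
have hs1 : hpieces h a s1 by apply: hpieces_eq hf; rewrite ls1.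
have hs2 : hpieces h b s2 by apply: hpieces_eq hg; rewrite ls2.
have hs : hpieces h a (s1 ++ s2) by apply: hpieces_cat hs1 _; rewrite ls1.
have ls : last a (s1 ++ s2) = c by rewrite last_cat ls1.
exists h; split.
- apply/horizontal_curveP; split; last by exists (s1 ++ s2).
  have -> : `[a, c]%classic = `[a, b] `|` `[b, c].
    apply/seteqP; split=> u /=; rewrite !in_itv/=.
      move=> /andP[au uc].
      by case: (leP u b) => [ub|/ltW bu]; [left; rewrite au|right; rewrite bu].
    move=> [/andP[-> ub]|/andP[bu ->]]; first exact: le_trans bc.
    by rewrite (le_trans ab).
  apply: withinU_continuous.
  + exact: itv_closed.
  + exact: itv_closed.
  + by apply: subspace_eq_continuous cf => u; rewrite inE; exact: hfE.
  + by apply: subspace_eq_continuous cg => u; rewrite inE; exact: hgE.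
- by rewrite -hfE// in_itv/= lexx.
- by rewrite -hgE// in_itv/= lexx bc.
- have mh : measurable_fun `[a, c] (speed h).
    by rewrite -ls; exact: hpieces_measurable.
  have mf : measurable_fun `[a, b] (speed f).
    by rewrite -ls1; exact: hpieces_measurable.
  have mg : measurable_fun `[b, c] (speed g).
    by rewrite -ls2; exact: hpieces_measurable.
  rewrite (@curve_length_eq a b f h _ mf); last by move=> u /subset_itv_oo_cc/hfE.
  rewrite (@curve_length_eq b c g h _ mg); last by move=> u /subset_itv_oo_cc/hgE.
  apply: (integral_itv_split _ mh (speed_ge0 h)).
  by rewrite ab.
Qed.

Lemma is_derive_affine p v c (u : R) : is_derive u 1 (fun u => p + (u - c) *: v) v.
Proof.
have E k : is_derive u 1 (fun u => (p + (u - c) *: v) 0 k) (v 0 k).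
  rewrite (_ : (fun u => _) = (fun u => p 0 k + (u - c) * v 0 k)); last first.
    by apply/funext => x; rewrite !mxE.
  by apply: is_derive_eq; rewrite scaler0 !add0r subr0 mul1r; exact: mulr1.
have D : derivable (fun u => p + (u - c) *: v) u 1.
  by apply/derivable_mxP => i k; rewrite ord1; case: (E k).
apply: DeriveDef => //; rewrite derive_mx//.
by apply/rowP => k; rewrite mxE derive_val.
Qed.

Lemma derive1_affine p v c : derive1 (fun u => p + (u - c) *: v) = cst v.
Proof.
apply/funext => u; rewrite derive1E.
have D := is_derive_affine p v c u.
by rewrite derive_val.
Qed.

Lemma smooth_affine p v c : smooth (fun u : R => p + (u - c) *: v).
Proof.
case=> [|k] u; first by rewrite /derive1n/=; have [] := is_derive_affine p v c u.
rewrite /derive1n iterSr derive1_affine.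
suff -> : iter k (@derive1 R H) (cst v) = cst (if k == 0 then v else 0).
  exact: derivable_cst.
elim: k => [|k IH] //=; rewrite IH.
by apply/funext => x; rewrite derive1_cst.
Qed.

End Curves.

(** * The Carnot-Caratheodory distance *)

Section Distance.
Variables (R : realType) (n : nat).
Local Notation H := (heis R n).
Implicit Types (p q v w : H) (f g : R -> H) (a b c d e u : R) (s : seq R).

Lemma segment_curve p v a : horizontal p v ->
  horizontal_curve a (a + 1) (fun u => p + (u - a) *: v).
Proof.
move=> pv; set f := fun u => _; have sf : smooth f by exact: smooth_affine.
apply/horizontal_curveP; split.
  by apply: continuous_subspaceT; exact: smooth_continuous.
exists [:: a + 1] => //=; split=> //; first by rewrite ltrDl.
split; first by exists f.
move=> u _; rewrite (derive1_affine p v a); apply/horizontalP.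
rewrite vertical_shift.
exact/horizontalP.
Qed.

Lemma segment_length p v a :
  curve_length a (a + 1) (fun u => p + (u - a) *: v) = (riem_norm p v)%:E.
Proof.
rewrite /curve_length.
under eq_integral do rewrite derive1_affine riem_norm_shift.
rewrite integral_cst//= lebesgue_measure_itv/= lte_fin ltrDl ltr01.
by rewrite -EFinB addrAC subrr add0r mule1.
Qed.

Lemma cc_dist_prepend p v q : horizontal p v ->
  (cc_dist p q <= cc_dist (p + v) q + (riem_norm p v)%:E)%E.
Proof.
move=> pv; rewrite -leeBlDr//; apply: le_ereal_inf_tmp.
move=> _ [a [b [f [ab hf fa fb ->]]]]; rewrite leeBlDr// addeC.
have := segment_curve (a - 1) pv; have := segment_length p v (a - 1).
rewrite subrK => <- hs.
have [||h [hh ha hb <-]] := curve_concat _ (ltW ab) hs hf.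
- by rewrite gerDl lerN10.
- by rewrite fa subKr scale1r.
apply: ereal_inf_lbound; exists (a - 1), b, h; split => //.
- by rewrite (lt_trans _ ab)// gtrDl ltrN10.
- by rewrite ha subrr scale0r addr0.
- by rewrite hb.
Qed.

Lemma cc_dist_append p v q : horizontal p v ->
  (cc_dist q (p + v) <= cc_dist q p + (riem_norm p v)%:E)%E.
Proof.
move=> pv; rewrite -leeBlDr//; apply: le_ereal_inf_tmp.
move=> _ [a [b [f [ab hf fa fb ->]]]]; rewrite leeBlDr//.
rewrite -(segment_length p v b).
have [||h [hh ha hb <-]] := curve_concat (ltW ab) _ hf (segment_curve b pv).
- by rewrite lerDl.
- by rewrite fb subrr scale0r addr0.
apply: ereal_inf_lbound; exists a, (b + 1), h; split => //.
- by rewrite (lt_trans ab)// ltrDl.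
- by rewrite ha.
- by rewrite hb addrAC subrr add0r scale1r.
Qed.

(** This is what a path of length at most e from p to p' gives, expressed on the
distance alone;
in this form it composes without any concatenation of paths. *)
Definition reach e p p' : Prop := forall q,
  (cc_dist p q <= cc_dist p' q + e%:E)%E /\ (cc_dist q p' <= cc_dist q p + e%:E)%E.

Lemma reach_trans e1 e2 p1 p2 p3 :
  reach e1 p1 p2 -> reach e2 p2 p3 -> reach (e1 + e2) p1 p3.
Proof.
move=> h12 h23 q; have [l1 r1] := h12 q; have [l2 r2] := h23 q; split.
- by rewrite (addrC e1) EFinD addeA (le_trans l1)// leeD2r.
- by rewrite EFinD addeA (le_trans r2)// leeD2r.
Qed.

Lemma reach_le e e' p p' : e <= e' -> reach e p p' -> reach e' p p'.
Proof.
move=> ee' h q; have [l r] := h q.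
by split; [apply: le_trans l _|apply: le_trans r _]; rewrite leeD2l// lee_fin.
Qed.

Lemma reach_step p v : horizontal p v -> reach (riem_norm p v) p (p + v).
Proof. by move=> pv q; split; [exact: cc_dist_prepend|exact: cc_dist_append]. Qed.

Lemma reach_fieldX p i a : reach `|a| p (p + a *: fieldX i p).
Proof.
rewrite -[`|a|]mulr1 -(riem_norm_fieldX p i) -riem_normZ; apply: reach_step.
by apply/horizontalP; rewrite verticalZ vertical_fieldX mulr0.
Qed.

Lemma reach_fieldY p i a : reach `|a| p (p + a *: fieldY i p).
Proof.
rewrite -[`|a|]mulr1 -(riem_norm_fieldY p i) -riem_normZ; apply: reach_step.
by apply/horizontalP; rewrite verticalZ vertical_fieldY mulr0.
Qed.

(** The cost is of order sqrt |t|, as it should be for the Carnot-Caratheodory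
metric; the index i provides a plane in which to run the parallelogram. *)
Lemma reach_fieldT (i : 'I_n) p t :
  reach (4 * Num.sqrt (`|t| / 2)) p (p + t *: fieldT p).
Proof.
set a := Num.sqrt _.
have a2 : a ^+ 2 = `|t| / 2 by rewrite sqr_sqrtr ?divr_ge0.
(* A parallelogram of signed area a * b = - t / 2 moves t by - 2 * a * b. *)
have [b bE abt] : exists2 b, `|b| = a & - (2 * a * b) = t.
  have [t0|t0] := leP 0 t.
    exists (- a); first by rewrite normrN ger0_norm ?sqrtr_ge0.
    by move: a2; rewrite ger0_norm// expr2 => a2; lra.
  exists a; first by rewrite ger0_norm ?sqrtr_ge0.
  by move: a2; rewrite ltr0_norm// expr2 => a2; lra.
have aE : `|a| = a by rewrite ger0_norm ?sqrtr_ge0.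
rewrite -abt -(four_steps p i a b).
apply: reach_le (reach_trans (reach_trans (reach_trans (reach_fieldX _ _ _)
  (reach_fieldY _ _ _)) (reach_fieldX _ _ _)) (reach_fieldY _ _ _)).
by rewrite !normrN bE aE; lra.
Qed.

(** The horizontal part of the displacement is travelled along a line, and the
remaining vertical part t along a parallelogram. *)
Definition cost p p' : R := let t := vertical p (p' - p) in
  riem_norm p (p' - p - t *: fieldT p) + 4 * Num.sqrt (`|t| / 2).

Lemma cost_ge0 p p' : 0 <= cost p p'.
Proof. by rewrite addr_ge0 ?mulr_ge0 ?sqrtr_ge0. Qed.

Lemma reach_cost (i : 'I_n) p p' : reach (cost p p') p p'.
Proof.
rewrite /cost; set t := vertical _ _; set v := _ - _ - _.
have pv : horizontal p v.
  apply/horizontalP; rewrite /v -scaleNr !verticalD -/t verticalZ vertical_fieldT.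
  by rewrite -verticalD -/t; ring.
have -> : p' = p + v + t *: fieldT (p + v).
  by rewrite /v /fieldT -addrA subrK addrC subrK.
exact: reach_trans (reach_step pv) (reach_fieldT i _ _).
Qed.

Lemma vertical0 p : vertical p 0 = 0.
Proof. by rewrite -(scale0r 0) verticalZ mul0r. Qed.

Lemma riem_norm0 p : riem_norm p 0 = 0.
Proof. by rewrite -(scale0r 0) riem_normZ normr0 mul0r. Qed.

(** Both arguments vary, so that the same statement controls the cost from p
to p' and from p' to p. *)
Lemma cvg_cost (T : Type) (F : set_system T) (P Q : T -> H) p :
  Filter F -> P @ F --> p -> Q @ F --> p ->
  cost (P u) (Q u) @[u --> F] --> 0.
Proof.
move=> FF Pp Qp.
have D0 : Q u - P u @[u --> F] --> (0 : H) by rewrite -(subrr p); exact: cvgB.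
have t0 : vertical (P u) (Q u - P u) @[u --> F] --> 0.
  by rewrite -(vertical0 p); exact: cvg_vertical.
have -> : 0 = riem_norm p (0 - 0 *: fieldT p) + 4 * Num.sqrt (`|0 : R| / 2) :> R.
  by rewrite scale0r subrr riem_norm0 normr0 mul0r sqrtr0 mulr0 addr0.
apply: cvgD.
  apply: cvg_riem_norm => //; apply: cvgB => //.
  by apply: cvgZr_tmp => //.
apply: cvgM; first exact: cvg_cst.
apply: cvg_comp; last exact: sqrt_continuous.
by apply: cvgM; [exact: cvg_norm|exact: cvg_cst].
Qed.

Lemma reach_near (i : 'I_n) p e : 0 < e ->
  \forall p' \near p, reach e p p' /\ reach e p' p.
Proof.
move=> e0.
have small (P Q : H -> H) : P @ p --> p -> Q @ p --> p ->
    \forall p' \near p, reach e (P p') (Q p').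
  move=> Pp Qp; have c0 := cvg_cost (nbhs_filter p) Pp Qp.
  have : \forall p' \near p, cost (P p') (Q p') < e by exact: (cvgr_lt _ c0).
  by apply: filterS => p' /ltW pe; exact: reach_le (reach_cost i _ _).
apply: filterI.
- exact: (small (fun=> p) id (@cvg_cst H p H (nbhs p) _) (@cvg_id H (nbhs p))).
- exact: (small id (fun=> p) (@cvg_id H (nbhs p)) (@cvg_cst H p H (nbhs p) _)).
Qed.

Lemma cc_dist_le_cost (i : 'I_n) p q : (cc_dist p q <= (cost p q)%:E)%E.
Proof.
have [le_pq _] := reach_cost i p q q; apply: le_trans le_pq _.
suff qq : (cc_dist q q <= 0)%E by rewrite -[leRHS]add0e leeD2r.
have q0 : horizontal q 0 by apply/horizontalP; exact: vertical0.
apply: ereal_inf_lbound; exists 0, (0 + 1), (fun u => q + (u - 0) *: 0).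
split; try by rewrite scaler0 addr0.
- by rewrite add0r.
- exact: segment_curve.
- by rewrite segment_length riem_norm0.
Qed.

(** The coordinates x and y move by at most r, which bounds the coefficients of
the form giving t' and thus the variation of t. *)
Lemma cc_ball_bounded p q (M r : R) : 0 <= r -> (forall k, `|p 0 k| <= M) ->
  (cc_dist p q < r%:E)%E ->
  forall k, `|q 0 k| <= M + r + n.*2%:R * (M + r) * r.
Proof.
move=> r0 pM /ereal_inf_lt[_ [a [b [f [ab hf fa fb ->]]]]].
move: hf => /horizontal_curveP[_ [s ls hs]] Lr.
have M0 : 0 <= M by apply: le_trans (pM it).
have growth C k : 0 <= C -> (forall u v, u \in `[a, b] -> horizontal (f u) v ->
    `|v 0 k| <= C * riem_norm (f u) v) ->
    forall u, u \in `[a, b] -> `|f u 0 k| <= M + C * r.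
  move=> C0 hC u uab; have fuk := hpieces_growth (k := k) hs C0; rewrite ls in fuk.
  have {fuk} : (`|f u 0 k - f a 0 k|%:E <= (C * r)%:E)%E.
    apply: le_trans (fuk hC u uab) _.
    by rewrite EFinM lee_wpmul2l ?lee_fin//; exact: ltW Lr.
  rewrite lee_fin fa -[f u 0 k](subrK (p 0 k)) => fp.
  apply: le_trans (ler_normD _ _) _; rewrite addrC lerD//.
  by rewrite subrK in fp.
have fx u i : u \in `[a, b] -> `|coordx (f u) i| <= M + r.
  rewrite -[r]mul1r; apply: growth => // x v _ _.
  by rewrite mul1r; exact: coordx_le_riem_norm.
have fy u i : u \in `[a, b] -> `|coordy (f u) i| <= M + r.
  rewrite -[r]mul1r; apply: growth => // x v _ _.
  by rewrite mul1r; exact: coordy_le_riem_norm.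
have Mr0 : 0 <= M + r by exact: addr_ge0.
have C0 : 0 <= n.*2%:R * (M + r) by rewrite mulr_ge0.
have bab : b \in `[a, b] by rewrite in_itv/= lexx ltW.
rewrite -fb; apply: heis_indexP => [i|i|].
- by apply: le_trans (fx b i bab) _; rewrite lerDl mulr_ge0.
- by apply: le_trans (fy b i bab) _; rewrite lerDl mulr_ge0.
apply: le_trans (growth _ _ C0 _ b bab) _; last first.
  by rewrite lerD2r lerDl.
move=> u v uab /horizontalP/eqP; rewrite subr_eq0 => /eqP; rewrite /coordt => ->.
apply: le_trans (ler_norm_sum _ _ _) _.
rewrite -muln2 natrM -!mulrA mulr_natl -[X in _ *+ X]card_ord -sumr_const.
apply: ler_sum => i _; apply: le_trans (ler_normB _ _) _; rewrite !normrM.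
rewrite mulr_natl mulr2n lerD// ler_pM//.
- exact: fy.
- exact: coordx_le_riem_norm.
- exact: fx.
- exact: coordy_le_riem_norm.
Qed.

End Distance.

(** * Nearest points *)

Section NearestPoint.
Variables (R : realType) (n : nat).
Local Notation H := (heis R n).
Implicit Types (p q : H) (E : set H).

Lemma near_coord_bounded p :
  \forall p' \near p, forall k, `|(p' : H) 0 k| <= \sum_j `|p 0 j| + 1.
Proof.
apply: (@filter_forall H _ (fun k q => `|q 0 k| <= _) (nbhs p)) => k.
have ck : (fun q : H => q 0 k) @ p --> p 0 k by exact: coord_continuous.
have /cvgrPdist_lt /(_ 1 ltr01) := ck; apply: filterS => q qk.
have le_sum : `|p 0 k| <= \sum_j `|p 0 j|.
  by rewrite (bigD1 k)//= lerDl sumr_ge0.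
rewrite -[q 0 k](subrK (p 0 k)); apply: le_trans (ler_normD _ _) _.
by rewrite addrC lerD// distrC ltW.
Qed.

(** For p' close to p with xi p' close to q, the distance from p to q is compared
with the one from p to a competitor q' through
d(p, q) <= d(p', q) + e/3 <= d(p', xi p') + 2e/3 <= d(p', q') + 2e/3
and d(p', q') <= d(p, q') + e/3. *)
Lemma cluster_nearest (i : 'I_n) E p (q : H) : closed E ->
  cluster (xi E @ within (Unp E) (nbhs p)) q -> nearest E p q.
Proof.
move=> cE clq; split.
  apply: cE => B qB; apply: clq qB.
  have FE : \forall p' \near p, Unp E p' -> E (xi E p').
    by apply: (@filterE H (nbhs p)) => p' /xiP[].
  exact: FE.
move=> q' Eq'; apply/lee_addgt0Pr => e e0.
have e3 : 0 < e / 3 by rewrite divr_gt0.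
pose A := [set y : H | exists p', [/\ Unp E p', reach (e / 3) p p',
  reach (e / 3) p' p & y = xi E p']].
have FA : \forall p' \near p, Unp E p' -> A (xi E p').
  apply: filterS (reach_near i p e3) => p' [pp' p'p] Up'.
  by exists p'.
have [y [[p' [Up' pp' p'p ->]] [_ xq]]] := clq _ _ FA (reach_near i q e3).
have [_ /(_ _ Eq') near_p'] := xiP Up'.
have -> : e = e / 3 + e / 3 + e / 3 by lra.
have [+ _] := pp' q; move/le_trans; apply.
rewrite !EFinD !addeA leeD2r//.
have [_ +] := xq p'; move/le_trans; apply.
rewrite leeD2r//; apply: le_trans near_p' _.
by have [] := p'p q'.
Qed.

(** The distance from p' to xi p' is at most the distance from p' to the fixed
point xi p, which is bounded for p' near p. *)
Lemma xi_near_bounded (i : 'I_n) E p : Unp E p ->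
  exists B : R, \forall p' \near p, Unp E p' -> forall k, `|xi E p' 0 k| <= B.
Proof.
move=> Up; have [Eq _] := xiP Up.
set M := \sum_j `|p 0 j| + 1; set r := cost p (xi E p) + 2.
exists (M + r + n.*2%:R * (M + r) * r).
have r0 : 0 <= r by rewrite addr_ge0 ?cost_ge0.
apply: filterS2 (near_coord_bounded p) (reach_near i p ltr01) => p' p'M [_ p'p] Up'.
apply: (@cc_ball_bounded _ _ p') => //.
have [_ /(_ _ Eq) le_p'] := xiP Up'; apply: le_lt_trans le_p' _.
have [+ _] := p'p (xi E p); move/le_lt_trans; apply.
have := cc_dist_le_cost i p (xi E p) => /(leeD2r 1)/le_lt_trans; apply.
by rewrite -EFinD lte_fin ltrD2l ltr1n.
Qed.

End NearestPoint.

Unset Implicit Arguments.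

Theorem proposition3p3 (R : realType) (n : nat) (hn : (1 <= n)%N)
    (E : set (heis R n)) (hE : closed E) :
  {within Unp E, continuous (xi E : heis R n -> heis R n)}.
Proof.
have i : 'I_n := Ordinal hn.
apply/subspace_continuousP => p Up.
have [B xiB] := xi_near_bounded i Up.
(* The second bound in C makes K a neighbourhood of q. *)
set q := xi E p; pose C := Num.max B (\sum_j `|q 0 j| + 1).
pose K : set (heis R n) := [set v | forall k, `[- C, C]%classic (v 0 k)].
have cK : compact K.
  by apply: (@rV_compact R _ (fun=> `[- C, C]%classic)) => k; exact: segment_compact.
have KP (v : heis R n) : (forall k, `|v 0 k| <= C) -> K v.
  by move=> vC k; rewrite /= in_itv/= -ler_norml.
have PF : ProperFilter (within (Unp E) (nbhs p)).
  by apply: within_nbhs_proper; exact: subset_closure.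
have FK : (xi E @ within (Unp E) (nbhs p)) K.
  have K_near : \forall p' \near p, Unp E p' -> K (xi E p').
    apply: filterS xiB => p' p'B Up'.
    by apply: KP => k; rewrite le_max p'B.
  exact: K_near.
have only_q (v : heis R n) : cluster (xi E @ within (Unp E) (nbhs p)) v -> v = q.
  move=> /(cluster_nearest i hE) pv; have [q' [_ uniq]] := Up.
  by rewrite -(uniq _ pv); exact: uniq (xiP Up).
apply: (compact_cluster_set1 _ cK _ _ FK).
- exact: norm_hausdorff.
- apply: filterS (near_coord_bounded q) => v vq; apply: KP => k.
  by rewrite le_max vq orbT.
- apply/seteqP; split=> [v /only_q//|_ ->].
  have [v [_ clv]] := cK _ (fmap_proper_filter _ PF) FK.
  by have vq := only_q v clv; rewrite vq in clv.
Qed.
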